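(* Let $\mathcal X$ be compactly contained in $\mathbb R^{\mathsf d}$ with diameter $D>0$. Let $P$ be the transition kernel of a uniformly ergodic Markov chain on $\mathcal X$ with invariant distribution $\pi^P$, and $Q$ the transition kernel of a Markov chain on $\mathcal X$ with unique invariant distribution $\pi^Q$. Suppose that $(P,Q)\in\mathcal T(\gamma,C,D)$, where the closed set $\mathcal X_Q$ in the definition of $\mathcal T(\gamma,C,D)$ is compactly contained in $\mathcal X$ and satisfies $N_{\mathcal X_Q}(\varepsilon,d|_{\mathcal X_Q})\le(1+k_QD/\varepsilon)^{\mathsf d_Q}$ for all $\varepsilon>0$, for some $\mathsf d_Q\le\mathsf d$ and $k_Q\ge1$, and let $\varepsilon_P$ be the minorization constant belonging to the minorizing measure $\nu^P$ in that definition. Then $$(\pi^P,\pi^Q)\in\begin{cases}\mathcal D\Big(\gamma+\mathsf d_Q,\ \frac{(2k_Q+1)^{\mathsf d_Q}}{C\varepsilon_P}\Big),&\text{if }\gamma+\mathsf d_Q\ge\mathsf d,\\[4pt]\mathcal D'\Big(\gamma+\mathsf d_Q,\ \mathsf d_Q,\ \frac{(2k_Q+1)^{\mathsf d_Q}}{(C\varepsilon_P)\wedge1}\Big),&\text{if }\gamma+\mathsf d_Q<\mathsf d.\end{cases}$$ In particular, one always has (irrespective of $\mathsf d_Q$ and $k_Q$) $(\pi^P,\pi^Q)\in\mathcal D\big(\gamma+\mathsf d,\ 9^{\mathsf d}/(C\varepsilon_P)\big)$.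
   Context: The metric $d$ on $\mathcal X\subset\mathbb R^{\mathsf d}$ is induced by some vector norm; $(\mathcal X,d)$ is complete and separable; $B(x,r)=\{y\in\mathcal X:d(x,y)\le r\}$; $a\wedge b=\min\{a,b\}$. $N_{\mathcal X_Q}(\varepsilon,d|_{\mathcal X_Q})$ is the $\varepsilon$-covering number of $\mathcal X_Q$: the smallest number of closed balls of radius $\varepsilon$ in the metric space $(\mathcal X_Q,d|_{\mathcal X_Q})$ whose union is $\mathcal X_Q$. Uniform ergodicity of $P$: $\lVert P^n(x,\cdot)-\pi^P\rVert_{\mathrm{TV}}\le c_P\kappa_P^n$ for all $x\in\mathcal X$, $n\in\mathbb N$, with some $c_P>0$, $\kappa_P\in(0,1)$; equivalently, there are $m_P\in\mathbb N$, $\varepsilon_P\in(0,1)$ and a probability measure $\nu^P$ on $\mathcal X$ with $P^{m_P}(x,\cdot)\ge\varepsilon_P\nu^P(\cdot)$ for all $x\in\mathcal X$. Such a $\nu^P$ is called a minorizing measure of $P$, with minorization constant $\varepsilon_P$. Kernel transfer exponent: $(P,Q)\in\mathcal T(\gamma,C,\overline h)$ (with $\gamma\ge0$, $C>0$, $\overline h>0$) if there exist a minorizing measure $\nu^P$ of $P$ and $m_Q\in\mathbb N$ such that for some closed set $\mathcal X_Q\subset\mathcal X$ with $\operatorname{supp}Q^{m_Q}(x,\cdot)\subset\mathcal X_Q$ for all $x\in\mathcal X$, one has $\nu^P(B(x,h))\ge C(h/\overline h)^\gamma Q^{m_Q}(y,B(x,h))$ for all $x,y\in\mathcal X_Q$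 and $h\in(0,\overline h]$. Similarity measure and $\alpha$-families: for probability measures $\mathbb P,\mathbb Q$ on $\mathcal X$ and $h>0$, $\rho_h(\mathbb P,\mathbb Q)=\int_{\mathcal X}\frac1{\mathbb P(B(x,h))}\,\mathbb Q(dx)$ with $1/0=+\infty$. For $\alpha\ge\mathsf d$, $C\ge1$, $\mathcal D(\alpha,C)$ is the set of pairs $(\mathbb P,\mathbb Q)$ of probability measures on $\mathcal X$ with $\sup_{0<h\le D}(h/D)^\alpha\rho_h(\mathbb P,\mathbb Q)\le C$. For $\alpha\in(0,\mathsf d)$, $\alpha'\in[0,\alpha]$, $C\ge1$, $\mathcal D'(\alpha,\alpha',C)$ is the set of pairs with $\sup_{0<h\le D}(h/D)^\alpha\rho_h(\mathbb P,\mathbb Q)\le C$ and $\sup_{0<h\le D}(h/D)^{\alpha'}\rho_h(\mathbb Q,\mathbb Q)\le C$.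
   Formalization: The family D'(α,α',C), defined in the paper only for α in (0,d), is extended to α=0, because for γ=d_Q=0 the proposition refers to the otherwise undefined D'(0,0,C); for α>0 nothing is changed. *)

(* Defs.v *)
From HB Require Import structures.
From mathcomp Require Import all_boot all_order all_algebra.
From mathcomp Require Import all_classical all_reals all_analysis.

Set Implicit Arguments.
Unset Strict Implicit.
Unset Printing Implicit Defensive.

Import Order.TTheory GRing.Theory Num.Theory.
Import numFieldNormedType.Exports.

Local Open Scope classical_set_scope.
Local Open Scope ring_scope.
Local Open Scope ereal_scope.

Definition is_vector_norm (R : realType) (n : nat) (N : 'rV[R]_n -> R) : Prop :=
  [/\ forall x y, (N (x + y)%R <= N x + N y)%R,
      forall (a : R) x, (N (a *: x)%R = `|a| * N x)%R &
      forall x, N x = 0%R -> x = 0%R].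

Definition diameter (R : realType) (n : nat) (N : 'rV[R]_n -> R)
    (X : set 'rV[R]_n) : R :=
  sup [set N (x - y)%R | x in X & y in X].

(* The subset X of R^n as a space of its own, with the subspace topology and
   the Borel sigma-algebra of that topology. All norms on R^n induce this
   topology. The nonemptiness proof X0 is there because a measurableType must
   be pointed; the choice of the point plays no role. *)
Definition state_space (R : realType) (n : nat) (X : set 'rV[R]_n)
  (X0 : X !=set0) : Type := set_type X.

Section state_space_structures.
Context (R : realType) (n : nat) (X : set 'rV[R]_n) (X0 : X !=set0).

Definition state_point : state_space X0 := exist _ (projT1 (cid X0))
  (mem_set (projT2 (cid X0))).

HB.instance Definition _ :=
  Topological.copy (state_space X0) (set_type X).
HB.instance Definition _ := isPointed.Build (state_space X0) state_point.
HB.instance Definition _ := Measurable.copy (state_space X0)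
  (g_sigma_algebraType (@open (state_space X0))).

Definition state_val (x : state_space X0) : 'rV[R]_n := sval x.

End state_space_structures.

Section metric.
Context (R : realType) (n : nat) (N : 'rV[R]_n -> R) (X : set 'rV[R]_n)
  (X0 : X !=set0).
Local Notation T := (state_space X0).

Definition ndist (x y : T) : R := N (state_val x - state_val y)%R.

Definition cball (x : T) (r : R) : set T := [set y | (ndist x y <= r)%R].

Definition ndist_complete : Prop :=
  forall u : nat -> T,
    (forall e : R, (0 < e)%R -> exists k : nat, forall i j : nat,
        (k <= i)%N -> (k <= j)%N -> (ndist (u i) (u j) < e)%R) ->
    exists l : T, forall e : R, (0 < e)%R -> exists k : nat, forall i : nat,
        (k <= i)%N -> (ndist (u i) l < e)%R.

(* The balls of the metric space A are the traces on A of the balls centred in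
   A. The value is +oo if no finite cover exists. *)
Definition covering_number (A : set T) (e : R) : \bar R :=
  ereal_inf [set k%:R%:E | k in
    [set k : nat | exists c : 'I_k -> T, (forall i, A (c i)) /\
       A = \bigcup_(i in [set: 'I_k]) (cball (c i) e `&` A)]].

End metric.

Section markov.
Context (R : realType) (n : nat) (X : set 'rV[R]_n) (X0 : X !=set0).
Local Notation T := (state_space X0).

Fixpoint kernel_iter (K : R.-pker T ~> T) (m : nat) : T -> set T -> \bar R :=
  if m is m'.+1 then fun x A => \int[K x]_y kernel_iter K m' y A
  else fun x A => \d_x A.

Definition invariant_prob (K : R.-pker T ~> T) (pi : probability T R) : Prop :=
  forall A : set T, measurable A -> \int[pi]_x K x A = pi A.

Definition unique_invariant_prob (K : R.-pker T ~> T) (pi : probability T R) :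
    Prop :=
  invariant_prob K pi /\
  forall mu : probability T R, invariant_prob K mu ->
    forall A : set T, measurable A -> mu A = pi A.

(* Normalised so as to take values in [0, 1]; the mass of the variation of
   mu - nu is twice this quantity. *)
Definition tv_dist (mu nu : set T -> \bar R) : \bar R :=
  ereal_sup [set `|mu A - nu A| | A in (measurable : set (set T))].

Definition uniformly_ergodic (K : R.-pker T ~> T) (pi : probability T R) :
    Prop :=
  exists c kappa : R, [/\ (0 < c)%R, (0 < kappa < 1)%R &
    forall (x : T) (m : nat),
      tv_dist (kernel_iter K m x) pi <= (c * kappa ^+ m)%:E].

Definition minorizing_with (K : R.-pker T ~> T) (nu : probability T R)
    (eps : R) : Prop :=
  (0 < eps < 1)%R /\
  exists m : nat, forall (x : T) (A : set T), measurable A ->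
    eps%:E * nu A <= kernel_iter K m x A.

Definition minorizing (K : R.-pker T ~> T) (nu : probability T R) : Prop :=
  exists eps : R, minorizing_with K nu eps.

Definition measure_support (mu : set T -> \bar R) : set T :=
  [set x | forall U : set T, open_nbhs x U -> 0 < mu U].

End markov.

Section transfer.
Context (R : realType) (n : nat) (N : 'rV[R]_n -> R) (X : set 'rV[R]_n)
  (X0 : X !=set0).
Local Notation T := (state_space X0).

Definition transfer_via (P Q : R.-pker T ~> T) (gamma C hbar : R)
    (nu : probability T R) (XQ : set T) : Prop :=
  [/\ (0 <= gamma)%R, (0 < C)%R, (0 < hbar)%R, minorizing P nu &
    exists mQ : nat,
      [/\ closed XQ,
          forall x : T, measure_support (kernel_iter Q mQ x) `<=` XQ &
          forall (x y : T) (h : R), XQ x -> XQ y -> (0 < h <= hbar)%R ->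
            (C * (h / hbar) `^ gamma)%:E * kernel_iter Q mQ y (cball N x h)
              <= nu (cball N x h)]].

(* The class of pairs with the given kernel transfer exponent. Results that
   refer to the measure nu or to the set XQ have to use transfer_via. *)
Definition transfer (P Q : R.-pker T ~> T) (gamma C hbar : R) : Prop :=
  exists (nu : probability T R) (XQ : set T),
    transfer_via P Q gamma C hbar nu XQ.

(* The inverse in \bar R satisfies 0^-1 = +oo. *)
Definition rho (h : R) (mu nu : probability T R) : \bar R :=
  \int[nu]_x (mu (cball N x h))^-1.

Definition sup_rho (D alpha : R) (mu nu : probability T R) : \bar R :=
  ereal_sup [set ((h / D) `^ alpha)%:E * rho h mu nu
            | h in [set h : R | (0 < h <= D)%R]].

Definition D_family (D alpha C : R) (mu nu : probability T R) : Prop :=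
  [/\ (n%:R <= alpha)%R, (1 <= C)%R & sup_rho D alpha mu nu <= C%:E].

(* alpha = 0 is admitted, so that the definition also covers a transfer
   exponent 0 combined with a target set of dimension 0. *)
Definition D_family' (D alpha alpha' C : R) (mu nu : probability T R) : Prop :=
  [/\ (0 <= alpha < n%:R)%R, (0 <= alpha' <= alpha)%R, (1 <= C)%R,
      sup_rho D alpha mu nu <= C%:E & sup_rho D alpha' nu nu <= C%:E].

End transfer.

(* Main.v *)
(** Minorization and invariance give [piP >= epsP * nuP]. Integrating the
    transfer inequality over its centre [y] against [piQ], which is invariant
    under [Q ^ mQ] and therefore carried by [XQ], gives
    [nuP (B x h) >= C (h / D) ^ gamma piQ (B x h)] on [XQ]. It remains to bound
    [\int 1 / piQ (B x h) d piQ]: if [k] balls [B z_i (h / 2)] cover [XQ], then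
    [B z_i (h / 2)] is contained in [B x h] for each [x] in it, so each of these
    balls contributes at most [1]. The last bound needs a cover with
    [k <= (4 D / h) ^ d], for which a maximal [h / 2]-separated set is taken;
    its cardinality is bounded by a tensor power trick instead of a volume
    comparison. *)

Require Import Defs.
From HB Require Import structures.
From mathcomp Require Import all_boot all_order all_algebra.
From mathcomp Require Import all_classical all_reals all_analysis.
From mathcomp Require Import measurable_realfun.
From mathcomp Require Import ring lra zify.

Set Implicit Arguments.
Unset Strict Implicit.
Unset Printing Implicit Defensive.

Import Order.TTheory GRing.Theory Num.Theory.
Import numFieldNormedType.Exports.

Local Open Scope classical_set_scope.
Local Open Scope ring_scope.

(* Unlike in [ge0_le_integral], [f] need not be measurable. *)
Lemma ge0_le_integralT d (T : measurableType d) (R : realType)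
    (mu : {measure set T -> \bar R}) (f g : T -> \bar R) :
  (forall x, 0 <= f x)%E -> (forall x, f x <= g x)%E ->
  (\int[mu]_x f x <= \int[mu]_x g x)%E.
Proof.
move=> f0 fg; rewrite !ge0_integralTE//; last first.
  by move=> x; exact: le_trans (fg x).
apply: le_ereal_sup => _ [h hf <-]; exists h => // x.
exact: le_trans (fg x).
Qed.

(** If [a < k], then [(a + 1) ^ l <= c * a ^ l] for all [l]; this contradicts the Bernoulli
    inequality at [l = c * a]. The case [a = 0], where that choice degenerates, is settled by
    [l = 1]. *)
Lemma leq_of_expn_leq (a c k : nat) :
  (forall l, k ^ l <= c * a ^ l)%N -> (k <= a)%N.
Proof.
move=> H; rewrite leqNgt; apply/negP => ak.
have bernoulli l : (a ^ l * (a + l) <= a * a.+1 ^ l)%N.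
  elim: l => [|l IH]; first by rewrite !expn0 mul1n muln1 addn0.
  rewrite expnSr (expnS a.+1) mulnCA.
  apply: leq_trans (leq_mul (leqnn a.+1) IH).
  by rewrite mulnCA -mulnA leq_mul2l; apply/orP; right; nia.
case: (posnP a) => [a0|a0]; first by have := H 1%N; rewrite a0 muln0 expn1; lia.
have h1 l : (a.+1 ^ l <= c * a ^ l)%N.
  by apply: leq_trans (H l); case: l => // l; rewrite leq_exp2r.
have := leq_trans (bernoulli (c * a)%N) (leq_mul (leqnn a) (h1 (c * a)%N)).
rewrite [leqRHS]mulnC mulnAC [leqLHS]mulnC leq_mul2r expn_eq0.
by lia.
Qed.

(** * Vector norms and the size of separated sets *)

Section vector_norm.
Context (R : realType) (d : nat) (N : 'rV[R]_d -> R).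
Hypothesis normN : is_vector_norm N.

Lemma vnormD x y : N (x + y) <= N x + N y.
Proof. by case: normN. Qed.

Lemma vnormZ a x : N (a *: x) = `|a| * N x.
Proof. by case: normN. Qed.

Lemma vnorm0 : N 0 = 0.
Proof. by rewrite -(scale0r 0) vnormZ normr0 mul0r. Qed.

Lemma vnormN x : N (- x) = N x.
Proof. by rewrite -scaleN1r vnormZ normrN1 mul1r. Qed.

Lemma vdistC x y : N (x - y) = N (y - x).
Proof. by rewrite -vnormN opprB. Qed.

Lemma vdist_triangle z x y : N (x - y) <= N (x - z) + N (z - y).
Proof. by apply: le_trans (vnormD _ _); rewrite addrA subrK. Qed.

Lemma vnorm_ge0 x : 0 <= N x.
Proof. by have := vnormD x (- x); rewrite subrr vnorm0 vnormN; lra. Qed.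

Lemma vnorm_le_mx_norm : exists2 K : R, 0 < K & forall x, N x <= K * `|x|.
Proof.
(* The sum comes from expanding [x] in the standard basis; the summand 1 gives positivity at once,
   also for [d = 0]. *)
exists (1 + \sum_j N (delta_mx 0 j)) => [|x].
  by rewrite ltr_pwDl// sumr_ge0// => j _; exact: vnorm_ge0.
have Nsum (I : Type) (r : seq I) (F : I -> 'rV[R]_d) :
    N (\sum_(i <- r) F i) <= \sum_(i <- r) N (F i).
  elim/big_ind2 : _ => [|u a v b ua vb|//]; first by rewrite vnorm0.
  by apply: le_trans (vnormD _ _) _; exact: lerD.
rewrite {1}[x]row_sum_delta (le_trans (Nsum _ _ _))//.
rewrite mulrDl mul1r mulr_suml ler_wpDl// ler_sum// => j _.
rewrite vnormZ mulrC ler_wpM2l ?vnorm_ge0//.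
rewrite [leRHS]/Num.norm/= mx_normrE.
by apply/bigmax_geP; right; exists (0, j).
Qed.

Lemma vnorm_continuous : continuous N.
Proof.
have [K K0 NK] := vnorm_le_mx_norm.
move=> x; have xF := nbhs_filter x; apply/cvgrPdist_le => e e0.
have eK : 0 < e / K by exact: divr_gt0.
apply: filterS (nbhsx_ballx x _ eK) => y.
rewrite mx_norm_ball => /ltW xy.
have Nxy : N (x - y) <= e.
  by apply: le_trans (NK _) _; rewrite mulrC -ler_pdivlMr.
have := vdist_triangle y x 0; have := vdist_triangle x y 0.
by rewrite !subr0 (vdistC y x) ler_norml; move: Nxy; lra.
Qed.

(* Tensor power trick: the sums [\sum_(j < L) M ^ j *: x (i j)] over words [i]
   of length [L] remain [s]-separated and lie in a box of size [O(M ^ L)], so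
   that [k ^ L = O(M ^ (d * L))] for all [L]. *)
Lemma separated_card (k m : nat) (x : 'I_k -> 'rV[R]_d) (s D : R) :
  (0 < m)%N -> 0 < s -> D <= s * m%:R ->
  (forall i j, N (x i - x j) <= D) ->
  (forall i j, i != j -> s <= N (x i - x j)) ->
  (k <= m.+1 ^ d)%N.
Proof.
move=> m0 s0 Dsm xD xs; set M := m.+1.
have M2 : 2 <= M%:R :> R by rewrite ler_nat.
have [K K0 NK] := vnorm_le_mx_norm.
pose y := foldr (fun i v => x i + M%:R *: v) 0.
have ysep (t u : seq 'I_k) : size t = size u -> t != u -> s <= N (y t - y u).
  elim: t u => [|i t IH] [|j u]//= [tu].
  rewrite eqseq_cons negb_and => tuneq.
  have -> : x i + M%:R *: y t - (x j + M%:R *: y u) =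
      (x i - x j) - M%:R *: (y u - y t).
    by rewrite scalerBr opprB opprD addrACA.
  (* Equal tails force distinct heads. Distinct tails contribute at least [M * s = (m + 1) * s], of
     which the heads cancel at most [D <= m * s]. *)
  have [tu_eq|tu_neq] := eqVneq t u.
    rewrite tu_eq subrr scaler0 subr0 xs//.
    by move: tuneq; rewrite tu_eq eqxx orbF.
  have := vdist_triangle (x i - x j) (M%:R *: (y u - y t)) 0.
  rewrite !subr0 vnormZ normr_nat (vdistC (M%:R *: _)) (vdistC (y u)).
  have : M%:R * s <= M%:R * N (y t - y u) by rewrite ler_wpM2l// IH.
  have := xD i j; rewrite -[M]addn1 natrD.
  by lra.
pose A := \sum_i `|x i|.
have A0 : 0 <= A by exact: sumr_ge0.
have ybound (t : seq 'I_k) : `|y t| <= A * (M%:R ^+ size t - 1).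
  elim: t => [|i t IH]/=; first by rewrite normr0 subrr mulr0.
  have xA : `|x i| <= A by rewrite /A (bigD1 i)//= lerDl sumr_ge0.
  apply: le_trans (ler_normD _ _) _; rewrite normrZ normr_nat exprS.
  have : M%:R * `|y t| <= M%:R * (A * (M%:R ^+ size t - 1)).
    by rewrite ler_pM2l// (lt_le_trans _ M2).
  by nra.
(* The mesh of a grid: points at sup-distance at most [eta] are at [N]-distance at most [s / 2],
   hence not [s]-separated. *)
pose eta := s / (2 * K).
have eta0 : 0 < eta by rewrite divr_gt0// mulr_gt0.
pose B := Num.truncn (2 * A / eta).
apply: (@leq_of_expn_leq _ (B.+2 ^ d)) => L.
have ML_gt0 : 0 < M%:R ^+ L :> R by rewrite exprn_gt0.
(* Coordinates in units of [eta], shifted to be nonnegative so that truncation yields the index of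
   the grid cell. *)
pose c (t : L.-tuple 'I_k) j := (y t 0 j + A * M%:R ^+ L) / eta.
have c_itv t j : 0 <= c t j < (B.+1 * M ^ L)%:R.
  have : `|y t 0 j| <= A * (M%:R ^+ L - 1).
    have := ybound t; rewrite size_tuple; apply: le_trans.
    rewrite [leRHS]/Num.norm/= mx_normrE.
    by apply/bigmax_geP; right; exists (0, j).
  rewrite ler_norml => /andP[lo hi]; apply/andP; split.
    by rewrite divr_ge0 ?(ltW eta0)//; nra.
  rewrite /c natrM natrX; apply: (@le_lt_trans _ _ (2 * A / eta * M%:R ^+ L)).
    by rewrite mulrAC ler_pM2r ?invr_gt0//; nra.
  by rewrite ltr_pM2r// truncnS_gt.
pose F (t : L.-tuple 'I_k) : {ffun 'I_d -> 'I_(B.+1 * M ^ L).+1} :=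
  [ffun j => inord (Num.truncn (c t j))].
(* Two words in the same cell are at sup-distance at most [eta], so by separation they coincide. *)
have Finj : injective F.
  move=> t u /ffunP Ftu; apply/val_inj/eqP/negP => /negP tu.
  have := ysep _ _ (etrans (size_tuple t) (esym (size_tuple u))) tu.
  apply/negP; rewrite -ltNge (le_lt_trans (NK _))//.
  suff : `|y t - y u| <= eta.
    rewrite -(ler_pM2l K0) => /le_lt_trans; apply.
    have -> : K * eta = s / 2 by rewrite /eta; field; rewrite gt_eqF.
    by lra.
  rewrite [leLHS]/Num.norm/= mx_normrE; apply: bigmax_le => [|[a j] _]/=.
    exact: ltW.
  rewrite !mxE (ord1 a).
  have /andP[ct0 ctB] := c_itv t j; have /andP[cu0 cuB] := c_itv u j.
  have tr z : 0 <= z < (B.+1 * M ^ L)%:R ->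
      (Num.truncn z < (B.+1 * M ^ L).+1)%N.
    by move=> /andP[z0 zB]; rewrite truncn_lt_nat// (lt_le_trans zB)// ler_nat.
  have : Num.truncn (c t j) = Num.truncn (c u j).
    by have := congr1 (@nat_of_ord _) (Ftu j); rewrite !ffunE !inordK ?tr.
  have /andP[] := truncn_itv ct0; have /andP[] := truncn_itv cu0.
  move=> l1 r1 l2 r2 e; move: l2 r2; rewrite e => l2 r2.
  have : `|c t j - c u j| <= 1.
    by rewrite ler_norml; move: r1 r2; rewrite -!natr1; lra.
  rewrite /c -mulrBl opprD addrACA subrr addr0 normrM normfV (gtr0_norm eta0).
  by rewrite ler_pdivrMr// mul1r.
have := leq_card F Finj; rewrite card_tuple card_ffun !card_ord => /leq_trans; apply.
rewrite -expnM (mulnC d) expnM -expnMn.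
have ML : (0 < M ^ L)%N by rewrite expn_gt0.
(* Passing from [B.+1] to [B.+2] absorbs the extra 1 in the number of cells, since [M ^ L >= 1]. *)
by case: (d) => // d'; rewrite leq_exp2r// mulSn; lia.
Qed.

End vector_norm.

(** * Borel sets and supports in the state space *)

Section state_space.
Context (R : realType) (d : nat) (X : set 'rV[R]_d) (X0 : X !=set0).
Local Notation T := (state_space X0).

Lemma state_val_continuous : continuous (@state_val R d X X0).
Proof. exact: initial_continuous. Qed.

Lemma state_open_measurable (A : set T) : open A -> measurable A.
Proof. exact: sub_sigma_algebra. Qed.

Lemma state_closed_measurable (A : set T) : closed A -> measurable A.
Proof.
by rewrite -openC => /state_open_measurable/measurableC; rewrite setCK.
Qed.

(** Each point outside [F] has a null open neighbourhood. Second countability, through balls with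
    rational centres and radii [1 / (k + 1)], reduces these to countably many null sets covering the
    complement. *)
Lemma measure_support_subset_closed (mu : {measure set T -> \bar R})
    (F : set T) : closed F -> measure_support mu `<=` F -> mu (~` F) = 0%E.
Proof.
move=> clF suppF.
have mF := measurableC (state_closed_measurable clF).
pose W (p : 'rV[rat]_d * nat) : set T :=
  @state_val R d X X0 @^-1` ball (map_mx ratr p.1 : 'rV[R]_d) p.2.+1%:R^-1.
have oW p : open (W p).
  apply: open_comp; last exact: ball_open.
  by move=> x _; exact: state_val_continuous.
(* An enumeration of the rational balls, in which those of positive measure are replaced by the
   empty set. *)
pose B i := if unpickle i is Some p then
  (if `[< mu (W p) = 0%E >] then W p else set0) else set0.
have B0 i : mu.-negligible (B i).
  rewrite /B; case: unpickle => [p|]; last exact: negligible_set0.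
  case: ifPn => [/asboolP Wp0|_]; last exact: negligible_set0.
  by exists (W p); split => //; exact: state_open_measurable.
apply/(measure_negligible mF)/(negligibleS _ (negligible_bigcup B0)) => x Fx.
have [V [[A oA] AV Vx] muV] : exists2 V, open_nbhs x V & mu V = 0%E.
  apply: contrapT => H; apply: Fx; apply: suppF => V Vx.
  rewrite lt0e measure_ge0 andbT; apply/eqP => V0; apply: H; by exists V.
have : nbhs (state_val x) A.
  by apply: open_nbhs_nbhs; split => //; move: Vx; rewrite -AV.
rewrite -nbhs_ballE => -[e /= e0 eA].
(* Half of [e], because a ball of this radius around a nearby rational point must stay inside the
   [e]-ball around [x]. *)
have [k _ ke] : exists2 k, True & k.+1%:R^-1 < e / 2 :> R.
  exists (Num.truncn (2 / e)) => //.
  by rewrite -[e / 2]invrK ltf_pV2 ?posrE ?invr_gt0 ?divr_gt0// invf_div truncnS_gt.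
have [q qP] : exists q : 'rV[rat]_d, forall j,
    `|state_val x 0 j - ratr (q 0 j)| < k.+1%:R^-1.
  have H j : exists r : rat, `|state_val x 0 j - ratr r| < k.+1%:R^-1.
    have [r] := @rat_in_itvoo R (state_val x 0 j - k.+1%:R^-1)
      (state_val x 0 j + k.+1%:R^-1) ltac:(by rewrite ltrD2l gtrN).
    rewrite in_itv/= => ?; exists r; rewrite distrC ltr_distl//.
  have [f fP] := choice H.
  by exists (\row_j f j) => j; rewrite mxE.
have xq : ball (map_mx ratr q : 'rV[R]_d) k.+1%:R^-1 (state_val x).
  split; first by rewrite invr_gt0.
  by move=> i j; rewrite mxE (ord1 i) /ball/= distrC.
have WV : W (q, k) `<=` V.
  move=> y; rewrite /W/= => qy; rewrite -AV /=; apply: eA.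
  apply: (@le_ball _ _ _ (k.+1%:R^-1 + k.+1%:R^-1)).
    by rewrite [leRHS]splitr lerD// ltW.
  by apply: ball_triangle qy; exact: ball_sym.
exists (pickle (q, k)) => //; rewrite /B pickleK.
case: ifPn => // /asboolP[].
apply/eqP; rewrite eq_le measure_ge0 andbT -muV le_measure// inE.
- exact: state_open_measurable.
- by apply: state_open_measurable; rewrite -AV; exists A.
Qed.

(** * Balls, coverings and the similarity measure *)

Section ball.
Context (N : 'rV[R]_d -> R).
Hypothesis normN : is_vector_norm N.

Lemma cball_measurable (x : T) r : measurable (cball N x r).
Proof.
apply: state_closed_measurable.
apply: (@preimage_closed _ _ (fun y : T => ndist N x y) [set t | t <= r]).
  move=> y _.
  apply: (@continuous_comp _ _ _ (fun y : T => state_val x - state_val y) N).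
    apply: (@continuous_comp _ _ _ (@state_val R d X X0)
      (fun u : 'rV[R]_d => state_val x - u)).
      exact: state_val_continuous.
    apply: (@continuousB _ _ _ (cst (state_val x)) id) => //.
    exact: cst_continuous.
  exact: vnorm_continuous.
exact: closed_le.
Qed.

Lemma cball_half_subset (z x : T) h : cball N z (h / 2) x ->
  cball N z (h / 2) `<=` cball N x h.
Proof.
rewrite /cball/ndist/= => zx y /= zy.
have := vdist_triangle normN (state_val z) (state_val x) (state_val y).
by rewrite (vdistC normN (state_val x) (state_val z)); lra.
Qed.

Lemma ndist_le_diameter : precompact X ->
  forall x y : T, ndist N x y <= diameter N X.
Proof.
rewrite precompactE => /compact_bounded[M [_ XM]] x y.
have [K K0 NK] := vnorm_le_mx_norm normN.
have X_le z : X z -> `|z| <= M + 1.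
  by move=> Xz; apply: XM; [lra|exact: subset_closure].
apply: ub_le_sup; last first.
  exists (state_val x); first exact: set_valP.
  by exists (state_val y) => //; exact: set_valP.
(* Boundedness of the set of distances matters: without an upper bound [sup] would be a default
   value. *)
exists (K * (M + 1 + (M + 1))) => _ [u Xu [v Xv <-]].
apply: le_trans (NK _) _; rewrite ler_pM2l//.
by apply: le_trans (ler_normB _ _) _; rewrite lerD// X_le.
Qed.

(** A separated family of maximal size is a cover, since an uncovered point could be added to it.
    The bound [k0] ensures that a maximal size exists. *)
Lemma exists_cover_by_packing (k0 : nat) (s : R) :
  (forall (k : nat) (c : 'I_k -> T),
     (forall i j, i != j -> s < ndist N (c i) (c j)) -> (k <= k0)%N) ->
  exists (k : nat) (c : 'I_k -> T),
    (k <= k0)%N /\ forall x, exists i, cball N (c i) s x.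
Proof.
move=> bnd.
pose P k := `[< exists c : 'I_k -> T,
  forall i j, i != j -> s < ndist N (c i) (c j) >].
have P0 : exists k, P k.
  by exists 0%N; apply/asboolP; exists (fun=> point) => -[].
have Pbnd k : P k -> (k <= k0)%N by move=> /asboolP[c /bnd].
have [k /asboolP[c cs] kmax] := ex_maxnP P0 Pbnd.
exists k, c; split; first exact: bnd cs.
move=> x; apply: contrapT => xc.
have far i : s < ndist N (c i) x.
  by rewrite ltNge; apply/negP => ?; apply: xc; exists i.
suff /kmax : P k.+1 by rewrite ltnn.
apply/asboolP; exists (fun i => if unlift ord0 i is Some j then c j else x).
move=> i j; case: unliftP => [i'|] ->; case: unliftP => [j'|] -> //.
- by rewrite (inj_eq lift_inj); exact: cs.
- by move=> _; rewrite /ndist vdistC//; exact: far.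
Qed.

Lemma rho_le_card (mu nu : probability T R) (A : set T) (h c : R) (k : nat)
    (z : 'I_k -> T) :
  0 < c -> measurable A -> nu (~` A) = 0%E ->
  (forall x, A x -> (c%:E * nu (cball N x h) <= mu (cball N x h))%E) ->
  (forall x, A x -> exists i, cball N (z i) (h / 2) x) ->
  (rho N h mu nu <= (k%:R / c)%:E)%E.
Proof.
move=> c0 mA nuA cA zA.
pose B i := cball N (z i) (h / 2).
have mB i : measurable (B i) by exact: cball_measurable.
(* This is [+oo] when [B i] is [nu]-null; the contribution [e i * nu (B i)] is then
   [+oo * 0 = 0]. *)
pose e i := (c%:E * nu (B i))^-1%E.
have e0 i : (0 <= e i)%E.
  by rewrite inve_ge0 mule_ge0// lee_fin ltW.
(* A measurable majorant of the integrand. The infinite term makes it dominate off [A] as well, and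
   integrates to 0 because [A] carries [nu]. *)
pose g x := (\sum_(i < k) e i * (\1_(B i) x)%:E + +oo * (\1_(~` A) x)%:E)%E.
have eB0 i x : (0 <= e i * (\1_(B i) x)%:E)%E.
  by rewrite mule_ge0// lee_fin.
have eA0 x : (0 <= +oo * (\1_(~` A) x)%:E :> \bar R)%E.
  by rewrite mule_ge0// lee_fin.
have fg x : ((mu (cball N x h))^-1 <= g x)%E.
  have [Ax|nAx] := pselect (A x); last first.
    rewrite /g indicE mem_set//= mule1 addey ?leey//.
    by rewrite gt_eqF// (lt_le_trans ltNy0)// sume_ge0.
  have [i zx] := zA x Ax.
  apply: (@le_trans _ _ (e i)).
    rewrite lee_pV2 ?inE ?measure_ge0 ?mule_ge0 ?lee_fin ?(ltW c0)//.
    apply: le_trans (cA _ Ax); rewrite lee_pmul2l ?lte_fin//.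
    apply: le_measure; rewrite ?inE//; first exact: cball_measurable.
    exact: cball_half_subset.
  rewrite /g (bigD1 i)//= indicE mem_set// mule1 -addeA leeDl//.
  by rewrite adde_ge0// sume_ge0.
have inv0 x : (0 <= (mu (cball N x h))^-1)%E by rewrite inve_ge0.
have me i : measurable_fun [set: T] (fun x => e i * (\1_(B i) x)%:E)%E.
  by apply: measurable_funeM; apply/measurable_EFinP; exact: measurable_indic.
have mE : measurable_fun [set: T] (fun x => +oo * (\1_(~` A) x)%:E : \bar R)%E.
  apply: measurable_funeM; apply/measurable_EFinP; apply: measurable_indic.
  exact: measurableC.
apply: le_trans (ge0_le_integralT nu inv0 fg) _.
rewrite /g ge0_integralD//; first last.
- exact: (emeasurable_sum _ me).
- by move=> x _; rewrite sume_ge0.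
rewrite ge0_integral_sum// ge0_integralZl//; last first.
  by apply/measurable_EFinP; apply: measurable_indic; exact: measurableC.
have -> : (\int[nu]_x (\1_(~` A) x)%:E = 0)%E.
  rewrite integral_indic//; last exact: measurableC.
  by rewrite setIT; exact: nuA.
rewrite mule0 adde0.
have -> : (k%:R / c)%:E = (\sum_(i < k) (c^-1)%:E)%E.
  by rewrite sumEFin sumr_const card_ord mulr_natl.
apply: lee_sum => i _.
rewrite ge0_integralZl//; last first.
  by apply/measurable_EFinP; exact: measurable_indic.
have -> : (\int[nu]_x (\1_(B i) x)%:E = nu (B i))%E.
  by rewrite integral_indic// setIT.
rewrite /e.
have /fineK nuE : nu (B i) \is a fin_num by exact: fin_num_measure.
rewrite -nuE; have [->|nuB] := eqVneq (fine (nu (B i))) 0.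
  by rewrite mule0 lee_fin invr_ge0 ltW.
rewrite -EFinM inver mulf_eq0 (negbTE nuB) orbF gt_eqF// -EFinM lee_fin.
by rewrite invfM mulfVK.
Qed.

(** The exponents add: [(h / D) ^ a] cancels the factor lost in comparing [mu] with [nu], and
    [(h / D) ^ b] compensates the number of balls in the cover. *)
Lemma sup_rho_le (mu nu : probability T R) (A : set T) (D a b c M : R) :
  0 < D -> 0 < c -> measurable A -> nu (~` A) = 0%E ->
  (forall h x, 0 < h <= D -> A x ->
    ((c * (h / D) `^ a)%:E * nu (cball N x h) <= mu (cball N x h))%E) ->
  (forall h, 0 < h <= D -> exists (k : nat) (z : 'I_k -> T),
    (h / D) `^ b * k%:R <= M /\
    forall x, A x -> exists i, cball N (z i) (h / 2) x) ->
  (sup_rho N D (a + b) mu nu <= (M / c)%:E)%E.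
Proof.
move=> D0 c0 mA nuA cA covA; apply: ge_ereal_sup => _ [h /= hD <-].
have [k [z [kM zA]]] := covA h hD.
have hD0 : 0 < h / D by case/andP: hD => h0 _; rewrite divr_gt0.
have pa : 0 < (h / D) `^ a by exact: powR_gt0.
have ca : 0 < c * (h / D) `^ a by exact: mulr_gt0.
have := rho_le_card ca mA nuA (fun x => cA h x hD) zA.
have pab : (0 <= ((h / D) `^ (a + b))%:E)%E by rewrite lee_fin powR_ge0.
move=> /(lee_wpmul2l pab) /le_trans; apply.
rewrite -EFinM lee_fin powRD; last by apply/implyP => _; rewrite gt_eqF.
have -> : (h / D) `^ a * (h / D) `^ b * (k%:R / (c * (h / D) `^ a)) =
    (h / D) `^ b * k%:R / c.
  by field; rewrite !gt_eqF.
by rewrite ler_pM2r// invr_gt0.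
Qed.

(** An infimum of natural numbers is attained unless no finite cover exists, and then it is [+oo],
    which the real bound [r] excludes. *)
Lemma covering_number_le (A : set T) (e r : R) :
  (covering_number N A e <= r%:E)%E ->
  exists (k : nat) (z : 'I_k -> T), k%:R <= r /\
    forall x, A x -> exists i, cball N (z i) e x.
Proof.
move=> Ar.
pose P k := `[< exists c : 'I_k -> T, (forall i, A (c i)) /\
       A = \bigcup_(i in [set: 'I_k]) (cball N (c i) e `&` A) >].
have [exP|nexP] := pselect (exists k, P k); last first.
  have : (+oo <= covering_number N A e)%E.
    apply/ereal_infP => y [k Pk _]; case: nexP; exists k; exact/asboolP.
  by move=> /le_trans/(_ Ar); rewrite leye_eq.
have [k /asboolP[z [_ Az]] kmin] := ex_minnP exP.
exists k, z; split; last first.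
  by move=> x Ax; move: (Ax); rewrite Az => -[i _ [zx _]]; exists i.
rewrite -lee_fin; apply: le_trans Ar.
apply/ereal_infP => _ [k' Pk' <-].
by rewrite lee_fin ler_nat kmin//; exact/asboolP.
Qed.

Lemma exists_cover_diameter (h : R) : precompact X ->
  0 < h <= diameter N X ->
  exists (k : nat) (z : 'I_k -> T),
    (h / diameter N X) ^+ d * k%:R <= 4 ^+ d /\
    forall x, exists i, cball N (z i) (h / 2) x.
Proof.
move=> pX; set D := diameter N X => /andP[h0 hD].
have D0 : 0 < D by exact: lt_le_trans hD.
(* Rounding up gives [D <= (h / 2) * m], while [h <= D] gives [m + 1 <= 2 * D / h + 2 <= 4 * D / h];
   this is the source of the base 4. *)
pose m := (Num.truncn (2 * D / h)).+1.
have mD : D <= h / 2 * m%:R.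
  rewrite -ler_pdivrMl ?divr_gt0// invf_div mulrAC.
  exact/ltW/truncnS_gt.
have mDh : m.+1%:R <= 4 * (D / h).
  have Dh : 1 <= D / h by rewrite ler_pdivlMr// mul1r.
  have : (Num.truncn (2 * D / h))%:R <= 2 * (D / h).
    by rewrite mulrA truncn_le divr_ge0 ?mulr_ge0 ?ltW.
  by rewrite -!natr1; lra.
have [|k [z [km zc]]] := @exists_cover_by_packing (m.+1 ^ d) (h / 2).
  move=> k c cs.
  apply: (@separated_card _ _ _ normN k m (fun i => state_val (c i)) (h / 2)
    D) => //.
  - by rewrite divr_gt0.
  - by move=> i j; exact: ndist_le_diameter.
  - by move=> i j ij; exact/ltW/cs.
exists k, z; split => //.
apply: (@le_trans _ _ ((h / D) ^+ d * (4 * (D / h)) ^+ d)).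
  rewrite ler_pM2l ?exprn_gt0 ?divr_gt0//.
  apply: (@le_trans _ _ (m.+1%:R ^+ d)); first by rewrite -natrX ler_nat.
  by rewrite lerXn2r// nnegrE ?ler0n// mulr_ge0// divr_ge0// ltW.
by rewrite -exprMn; have -> : h / D * (4 * (D / h)) = 4 by field; rewrite !gt_eqF.
Qed.

End ball.
End state_space.

(** * Iterated kernels and invariance *)

Section markov_kernel.
Context (R : realType) (d : nat) (X : set 'rV[R]_d) (X0 : X !=set0).
Local Notation T := (state_space X0).
Local Open Scope ereal_scope.

(** The iterates as bundled s-finite kernels, from which [kernel_iter] inherits measurability in the
    starting point and the measure axioms. *)
Fixpoint power_kernel (K : R.-pker T ~> T) (m : nat) : R.-spker T ~> T :=
  if m is m'.+1 then mkcomp_noparam K (power_kernel K m')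
  else kdirac (@measurable_id _ T setT).

Lemma power_kernelE (K : R.-pker T ~> T) m (x : T) A :
  power_kernel K m x A = kernel_iter K m x A.
Proof.
elim: m x => [|m IH] x//=.
by apply: eq_integral => y _; rewrite IH.
Qed.

Lemma measurable_kernel_iter (K : R.-pker T ~> T) m A : measurable A ->
  measurable_fun [set: T] ((kernel_iter K m)^~ A : T -> \bar R).
Proof.
move=> mA; under eq_fun do rewrite -power_kernelE.
exact: measurable_kernel.
Qed.

Lemma kernel_iter_ge0 (K : R.-pker T ~> T) m (x : T) A : 0 <= kernel_iter K m x A.
Proof. by rewrite -power_kernelE. Qed.

Lemma kernel_iterT (K : R.-pker T ~> T) m (x : T) : kernel_iter K m x [set: T] = 1.
Proof.
elim: m x => [|m IH] x /=; first by rewrite diracT.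
under eq_integral do rewrite IH.
by rewrite integral_cst// mul1e prob_kernel.
Qed.

Section invariant.
Variables (K : R.-pker T ~> T) (pi : probability T R).
Hypothesis invK : invariant_prob K pi.

Lemma integral_invariant (f : T -> \bar R) :
  (forall x, 0 <= f x) -> measurable_fun [set: T] f ->
  \int[pi]_x \int[K x]_y f y = \int[pi]_x f x.
Proof.
move=> f0 mf.
(* To apply [integral_kcomp], [pi] becomes a constant kernel, evaluated at the arbitrary [point],
   and [K] a kernel on pairs that ignores the first coordinate. *)
pose l : R.-pker T ~> T :=
  kprobability (@measurable_cst _ _ T _ setT (pi : pprobability T R)).
pose k : R.-spker (T * T)%type ~> T := kernel.kernel_snd (K : R.-spker T ~> T).
have := @integral_kcomp _ _ _ T T T R l k point f f0 mf.
rewrite /= => <-.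
apply: eq_measure_integral => A mA _.
exact: invK.
Qed.

Lemma invariant_kernel_iter m A : measurable A ->
  \int[pi]_x kernel_iter K m x A = pi A.
Proof.
move=> mA; elim: m => [|m IH] /=.
  by rewrite (eq_integral (fun x => (\1_A x)%:E))// integral_indic// setIT.
rewrite integral_invariant//; last exact: measurable_kernel_iter.
by move=> x; exact: kernel_iter_ge0.
Qed.

Lemma minorizing_le (nu : probability T R) (eps : R) A : measurable A ->
  minorizing_with K nu eps -> eps%:E * nu A <= pi A.
Proof.
move=> mA [/andP[eps0 _] [m Km]].
rewrite -(invariant_kernel_iter m mA).
have -> : eps%:E * nu A = \int[pi]_x (cst (eps%:E * nu A) x).
  by rewrite integral_cst//= probability_setT mule1.
apply: ge0_le_integral => //.
- by move=> x _; rewrite mule_ge0// lee_fin ltW.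
- exact: measurable_kernel_iter.
- by move=> x _; exact: Km.
Qed.

End invariant.
End markov_kernel.

(** * Transfer of the inequality to the invariant distribution *)

Section transfer_family.
Context (R : realType) (d : nat) (N : 'rV[R]_d -> R) (X : set 'rV[R]_d)
  (X0 : X !=set0).
Local Notation T := (state_space X0).
Variables (Q : R.-pker T ~> T) (piQ nuP : probability T R) (XQ : set T).
Variables (m : nat).
Hypotheses (normN : is_vector_norm N) (invQ : invariant_prob Q piQ).
Hypothesis closedXQ : closed XQ.
Hypothesis suppXQ : forall x, measure_support (kernel_iter Q m x) `<=` XQ.

Lemma invariant_prob_setC0 : piQ (~` XQ) = 0%E.
Proof.
have mXQ := measurableC (state_closed_measurable closedXQ).
rewrite -(invariant_kernel_iter invQ m mXQ); apply: integral0_eq => x _.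
rewrite -power_kernelE; apply: measure_support_subset_closed => // y.
have -> : measure_support (power_kernel Q m x) =
    measure_support (kernel_iter Q m x).
  by congr measure_support; apply/funext => A; exact: power_kernelE.
exact: suppXQ.
Qed.

(** Average over [y] under [piQ]: invariance turns the left side into [piQ B], and the right side is
    constant. The bound is assumed on [XQ] only, so the integrands are compared almost
    everywhere. *)
Lemma kernel_iter_le_invariant (a : R) (B : set T) : 0 <= a -> measurable B ->
  (forall y, XQ y -> (a%:E * kernel_iter Q m y B <= nuP B)%E) ->
  (a%:E * piQ B <= nuP B)%E.
Proof.
move=> a0 mB aQ; rewrite -(invariant_kernel_iter invQ m mB).
have mk := measurable_kernel_iter Q m mB.
rewrite -ge0_integralZl//; last by move=> x _; exact: kernel_iter_ge0.
have -> : nuP B = (\int[piQ]_x cst (nuP B) x)%E.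
  by rewrite integral_cst//= probability_setT mule1.
apply: ae_ge0_le_integral => //.
- by move=> x _; rewrite mule_ge0// kernel_iter_ge0.
- exact: measurable_funeM.
- exists (~` XQ); split; first exact: measurableC (state_closed_measurable closedXQ).
    exact: invariant_prob_setC0.
  by move=> x /= H XQx; apply: H => _; exact: aQ.
Qed.

End transfer_family.

(** * Membership in the families and their constants *)

Theorem proposition5p10 (R : realType) (d : nat) (N : 'rV[R]_d -> R)
    (X : set 'rV[R]_d) (X0 : X !=set0) (D : R)
    (P Q : R.-pker (state_space X0) ~> (state_space X0))
    (piP piQ nuP : probability (state_space X0) R)
    (XQ : set (state_space X0)) (gamma C epsP : R)
    (normN : is_vector_norm N)
    (complX : ndist_complete N X0)
    (precX : precompact X)
    (defD : D = diameter N X) (D_gt0 : 0 < D)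
    (invP : invariant_prob P piP) (ergP : uniformly_ergodic P piP)
    (invQ : unique_invariant_prob Q piQ)
    (transPQ : transfer_via N P Q gamma C D nuP XQ)
    (minP : minorizing_with P nuP epsP)
    (precXQ : precompact XQ) :
  (forall dQ kQ : R, dQ <= d%:R -> 1 <= kQ ->
     (forall e : R, 0 < e ->
        (covering_number N XQ e <= ((1 + kQ * D / e) `^ dQ)%:E)%E) ->
     (d%:R <= gamma + dQ ->
        D_family N D (gamma + dQ) ((2 * kQ + 1) `^ dQ / (C * epsP)) piP piQ) /\
     (gamma + dQ < d%:R ->
        D_family' N D (gamma + dQ) dQ
          ((2 * kQ + 1) `^ dQ / Num.min (C * epsP) 1) piP piQ)) /\
  D_family N D (gamma + d%:R) (9 ^+ d / (C * epsP)) piP piQ.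
Proof.
have [gamma0 C0 _ _ [m [closedXQ suppXQ trQ]]] := transPQ.
have {invQ} [invQ _] := invQ.
have /andP[eps0 eps1] := minP.1.
have mXQ := state_closed_measurable closedXQ.
have XQ0 := invariant_prob_setC0 invQ closedXQ suppXQ.
have [y XQy] : XQ !=set0.
  apply/set0P/eqP => XQe; move: XQ0; rewrite XQe setC0 probability_setT.
  by move/eqP; rewrite onee_eq0.
have ballD (x : state_space X0) : cball N x D = setT.
  by apply/seteqP; split => // z _; rewrite defD;
    exact: (ndist_le_diameter normN precX).
(* At [h = D] every ball is the whole space, so the transfer inequality compares total masses. Hence
   [C * epsP <= 1], which makes the family constants at least 1 and determines the minimum. *)
have C1 : C <= 1.
  have := trQ y y D XQy XQy; rewrite D_gt0 lexx => /(_ isT).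
  rewrite divff ?gt_eqF// powR1 mulr1 ballD kernel_iterT probability_setT mule1.
  by rewrite lee_fin.
have Ceps0 : 0 < C * epsP by exact: mulr_gt0.
have Ceps1 : C * epsP <= 1 by rewrite mulr_ile1// ltW.
have PQ (h : R) (x : state_space X0) : 0 < h <= D -> XQ x ->
    ((C * epsP * (h / D) `^ gamma)%:E * piQ (cball N x h)
      <= piP (cball N x h))%E.
  move=> hD XQx; have mB := cball_measurable normN x h.
  apply: le_trans (minorizing_le invP mB minP).
  rewrite (mulrC C) -mulrA EFinM -muleA lee_pmul2l//.
  apply: (kernel_iter_le_invariant invQ closedXQ suppXQ) => //.
    by rewrite mulr_ge0 ?powR_ge0// ltW.
  by move=> z XQz; exact: trQ.
(* The trivial comparison, put in the form [a = 0], [c = 1] of [sup_rho_le] to bound the similarity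
   of [piQ] with itself. *)
have QQ (h : R) (x : state_space X0) : 0 < h <= D -> XQ x ->
    ((1 * (h / D) `^ 0)%:E * piQ (cball N x h) <= piQ (cball N x h))%E.
  by move=> _ _; rewrite powRr0 mulr1 mul1e.
split; last first.
  have M1 : 1 <= 9 ^+ d :> R by rewrite exprn_ege1// ler1n.
  split.
  - by rewrite lerDr.
  - by rewrite ler_pdivlMr// mul1r (le_trans Ceps1).
  apply: sup_rho_le mXQ XQ0 PQ _ => // h hD.
  have [|k [z [kM zc]]] := @exists_cover_diameter R d X X0 N normN h precX.
    by rewrite -defD.
  exists k, z; split => //; rewrite powR_mulrn -?defD; last first.
    by case/andP: hD => h0 _; rewrite divr_ge0// ltW.
  (* The packing cover gives [4 ^ d], which is weakened to [9 ^ d]. *)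
  rewrite defD; apply: le_trans kM _.
  by rewrite lerXn2r ?nnegrE// ler_nat.
move=> dQ kQ dQd kQ1 covQ.
(* For negative [dQ] the covering bound at radius [D] would be below 1, but the nonempty [XQ] takes
   at least one ball. *)
have dQ0 : 0 <= dQ.
  rewrite leNgt; apply/negP => dQ0.
  have [k [z [kr /(_ y XQy)[i _]]]] := covering_number_le (covQ _ D_gt0).
  move: kr; apply/negP; rewrite -ltNge mulfK ?gt_eqF//.
  have k1 : 1 <= k%:R :> R by rewrite ler1n (leq_ltn_trans _ (ltn_ord i)).
  apply: lt_le_trans k1; rewrite -[dQ]opprK powRN invf_lt1 ?powR_gt0; [|lra..].
  have : 1 `^ (- dQ) < (1 + kQ) `^ (- dQ) by rewrite gt0_ltr_powR ?nnegrE; lra.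
  by rewrite powR1.
have cov h : 0 < h <= D -> exists (k : nat) (z : 'I_k -> state_space X0),
    (h / D) `^ dQ * k%:R <= (2 * kQ + 1) `^ dQ /\
    forall x, XQ x -> exists i, cball N (z i) (h / 2) x.
  move=> /andP[h0 hD]; have h20 : 0 < h / 2 by rewrite divr_gt0.
  have [k [z [kr zc]]] := covering_number_le (covQ _ h20).
  exists k, z; split => //.
  have hD0 : 0 <= h / D by rewrite divr_ge0// ltW.
  have kDh0 : 0 <= 1 + kQ * D / (h / 2).
    by rewrite addr_ge0// divr_ge0 ?mulr_ge0 ?ltW//; lra.
  apply: (@le_trans _ _ ((h / D) `^ dQ * (1 + kQ * D / (h / 2)) `^ dQ)).
    by rewrite ler_wpM2l// powR_ge0.
  have hD1 : h / D <= 1 by rewrite ler_pdivrMr// mul1r.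
  (* The radius [h / 2] doubles [kQ], and [h / D <= 1] supplies the remaining 1 in [2 * kQ + 1]. *)
  have hkE : h / D * (1 + kQ * D / (h / 2)) = h / D + 2 * kQ.
    by field; rewrite !gt_eqF.
  by rewrite -powRM// hkE ge0_ler_powR ?nnegrE; lra.
have M1 : 1 <= (2 * kQ + 1) `^ dQ.
  have : 1 `^ dQ <= (2 * kQ + 1) `^ dQ by rewrite ge0_ler_powR ?nnegrE; lra.
  by rewrite powR1.
have MC1 : 1 <= (2 * kQ + 1) `^ dQ / (C * epsP).
  by rewrite ler_pdivlMr// mul1r (le_trans Ceps1).
have PQle : (sup_rho N D (gamma + dQ) piP piQ
    <= ((2 * kQ + 1) `^ dQ / (C * epsP))%:E)%E.
  exact: sup_rho_le mXQ XQ0 PQ cov.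
split => [dg|dg]; first by split.
rewrite min_l//; split => //.
- by rewrite addr_ge0.
- by rewrite dQ0 lerDr.
(* This gives the exponent [0 + dQ] with a constant lacking the divisor [C * epsP]; dividing by a
   number at most 1 only enlarges it. *)
have := sup_rho_le normN D_gt0 ltr01 mXQ XQ0 QQ cov.
rewrite add0r divr1 => /le_trans; apply.
by rewrite lee_fin ler_pdivlMr// ler_piMr// powR_ge0.
Qed.
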